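(* Let $(G,H)=(\mathrm O_n(\mathbb C),\mathrm O_m(\mathbb C)\times\mathrm O_{n-m}(\mathbb C))$ with $0<m<n$, $G_0=\mathrm{SO}_n(\mathbb C)$, and $0\le r\le\lfloor n/2\rfloor$. An $H$-orbit $\mathcal O(r_U,r_W,a,b)$ in $\mathrm{Gr}_G(r)$ always decomposes into $1$ or $2$ $(H\cap G_0)$-orbits. Moreover, the following are equivalent: (i) $\mathcal O(r_U,r_W,a,b)$ decomposes into $2$ $(H\cap G_0)$-orbits; (ii) both equalities $2r_U+2a+b=m$ and $2r_W+2a+b=n-m$ hold; (iii) $r+a=n/2$.
   Context: $V\simeq\mathbb C^n$ has a nondegenerate symmetric bilinear form $B$, $V=U\oplus W$ with $U\perp W$, $\dim U=m$, $\dim W=n-m$. $G$ is the isometry group of $V$ and $H\subset G$ the product of the isometry groups of $U$ and $W$; $G_0$ is the identity component of $G$. $\mathrm{Gr}_G(r)$ is the projective variety of $r$-dimensional subspaces $S$ of $V$ with $S\perp S$. For a subspace $X$, $\mathrm{Rad}(X)=X\cap X^\perp$; $\mathbf P_US=(S+W)\cap U$, $\mathbf P_WS=(S+U)\cap W$. For $S\in\mathrm{Gr}_G(r)$: $r_U(S)=\dim(S\cap U)$, $r_W(S)=\dim(S\cap W)$, $a(S)=\dim\frac{\mathrm{Rad}(\mathbf P_US)}{S\cap U}=\dim\frac{\mathrm{Rad}(\mathbf P_WS)}{S\cap W}$, $b(S)=\dim\frac{\mathbf P_US}{\mathrm{Rad}(\mathbf P_US)}$. The 4-tuple $(r_U(S),r_W(S),a(S),b(S))$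 determines the $H$-orbit of $S$ and satisfies $r_U+r_W+a+b=r$, $2r_U+2a+b\le m$, $2r_W+2a+b\le n-m$; $\mathcal O(r_U,r_W,a,b)$ denotes the $H$-orbit with this 4-tuple. *)

(* Defs.v *)
From HB Require Import structures.
From mathcomp Require Import all_boot all_order all_algebra.
From mathcomp Require Import complex.
From mathcomp Require Import mathcomp_extra boolp classical_sets functions cardinality reals.

Set Implicit Arguments.
Unset Strict Implicit.
Unset Printing Implicit Defensive.

Import GRing.Theory.

Local Open Scope classical_set_scope.
Local Open Scope ring_scope.

Definition isometries (F : fieldType) (V : vectType F) (f : V -> V -> F) :
    set 'End(V) :=
  [set g | lker g = 0%VS /\ forall u v, f (g u) (g v) = f u v].

Definition restrict_form (F : fieldType) (V : vectType F) (B : V -> V -> F)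
    (X : {vspace V}) : subvs_of X -> subvs_of X -> F :=
  fun x y => B (vsval x) (vsval y).

(* The isometry groups of U and W are groups of endomorphisms of U and W
   themselves; the pair (gU, gW) acts on V = U (+) W by u + w |-> gU u + gW w. *)
Definition product_isometries (F : fieldType) (V : vectType F)
    (B : V -> V -> F) (U W : {vspace V}) : set 'End(V) :=
  [set g | exists gU gW,
     [/\ isometries (restrict_form B (X := U)) gU,
         isometries (restrict_form B (X := W)) gW &
         forall (u : subvs_of U) (w : subvs_of W),
           g (vsval u + vsval w) = vsval (gU u) + vsval (gW w)]].

Definition lfun_det (F : fieldType) (V : vectType F) (g : 'End(V)) : F :=
  \det (passmx.mxof (vbasis {:V}) (vbasis {:V}) g).

Definition special_isometries (F : fieldType) (V : vectType F)
    (f : V -> V -> F) : set 'End(V) :=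
  isometries f `&` [set g | lfun_det g = 1].

Section IsotropicSubspaces.
Context {F : fieldType} {V : vectType F} (B : {symmetric V}).
Implicit Types (U W S X : {vspace V}).

Definition isotropic_Gr (r : nat) : set {vspace V} :=
  [set S | \dim S = r /\ (S <= orthov B S)%VS].

Definition Rad X : {vspace V} := (X :&: orthov B X)%VS.

(* proj_along W U S is the projection P_U S of S to U along W. *)
Definition proj_along W U S : {vspace V} := ((S + W) :&: U)%VS.

Lemma capv_sub_Rad U W S : (U <= orthov B W)%VS -> (S <= orthov B S)%VS ->
  (S :&: U <= Rad (proj_along W U S))%VS.
Proof.
move=> oUW oSS; rewrite /Rad /proj_along subv_cap capvS ?addvSl //=.
suff h : (S :&: U <= orthov B (S + W))%VS.
  by apply: subv_trans h _; rewrite orthov_sym (subv_trans (capvSl _ _)) // orthov_sym.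
by rewrite orthovD (subv_trans (capvSl _ _) oSS) (subv_trans (capvSr _ _) oUW).
Qed.

(* capv_sub_Rad makes the first truncated subtraction a genuine quotient
   dimension.  Exchanging U and W in a_inv gives the same number. *)
Definition a_inv U W S : nat :=
  (\dim (Rad (proj_along W U S)) - \dim (S :&: U))%N.

Definition b_inv U W S : nat :=
  (\dim (proj_along W U S) - \dim (Rad (proj_along W U S)))%N.

Definition orbit_invariants U W S : nat * nat * nat * nat :=
  (\dim (S :&: U), \dim (S :&: W), a_inv U W S, b_inv U W S).

Definition orbit (K : set 'End(V)) S : set {vspace V} :=
  [set (g @: S)%VS | g in K].

(* O is an H-orbit O(rU, rW, a, b) in Gr_G(r). *)
Definition orbit_with_invariants (H : set 'End(V)) U W (r rU rW a b : nat)
    (O : set {vspace V}) : Prop :=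
  exists S, [/\ isotropic_Gr r S, orbit_invariants U W S = (rU, rW, a, b) &
                O = orbit H S].

Definition decomposes_into (k : nat) (K : set 'End(V))
    (O : set {vspace V}) : Prop :=
  ([set orbit K S | S in O] #= `I_k)%card.

End IsotropicSubspaces.

(* Main.v *)
(* The determinant takes values +-1 on H, and H contains reflections, so the
   H-orbit of S splits into two orbits of H `&` SO(V) unless the stabilizer of S
   in H contains an element of determinant -1.
   Let P and Q be the projections of S to U and W.  One has
   m >= dim P + dim (Rad P) = 2 rU + 2 a + b; if the inequality is strict, the
   orthogonal of P in U is not totally isotropic, and the reflection along an
   anisotropic vector of it fixes S pointwise; likewise for Q in W.
   On the other hand S + Rad P = S + Rad Q is isotropic of dimension r + a and
   stable under the stabilizer of S; if 2 (r + a) = n it is Lagrangian, and an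
   isometry stabilizing a Lagrangian acts on the quotient by the inverse
   transpose of its restriction, hence has determinant 1. *)

Require Import Defs.
From HB Require Import structures.
From mathcomp Require Import all_boot all_order all_algebra.
From mathcomp Require Import complex.
From mathcomp Require Import mathcomp_extra boolp classical_sets functions cardinality reals.
From mathcomp Require Import zify ring.

Set Implicit Arguments.
Unset Strict Implicit.
Unset Printing Implicit Defensive.

Import GRing.Theory passmx.

Local Open Scope classical_set_scope.
Local Open Scope ring_scope.

(** * Two determinant computations on matrices *)

(** Both sides of [e] are products of block triangular matrices, so comparing determinants gives the
    rank-one formula. It serves to compute the determinant of a reflection. *)
Lemma det_1D_mul_col_row (F : comNzRingType) n (v : 'cV[F]_n) (w : 'rV[F]_n) :
  \det (1%:M + v *m w) = 1 + (w *m v) 0 0.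
Proof.
have e : block_mx (1%:M + v *m w) v 0 1%:M *m block_mx 1%:M 0 (- w) 1%:M =
         block_mx 1%:M 0 (- w) 1%:M *m block_mx 1%:M v 0 (1%:M + w *m v).
  rewrite !mulmx_block !mul1mx !mulmx1 !mul0mx !mulmx0 !addr0 !add0r.
  rewrite mulmxN addrK mulNmx; congr block_mx.
  by rewrite addrCA addNr addr0.
move/(congr1 determinant): e.
rewrite !det_mulmx !det_ublock !det_lblock !det1 !mul1r !mulr1 => ->.
by rewrite [X in \det X]mx11_scalar det_scalar1 !mxE eqxx.
Qed.

(** In a basis whose first [k] vectors span the row space of [X], [G] becomes block lower triangular
    with diagonal blocks A and D, and the Gram matrix gets a zero upper left block and an invertible
    upper right block K. Invariance of the form gives A K D^T = K, hence det A * det D = 1. *)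
Lemma det_isometry_stable_lagrangian (F : fieldType) n k (G J : 'M[F]_n)
    (X : 'M[F]_(k, n)) :
  n = (k + k)%N -> J \in unitmx -> G *m J *m G^T = J ->
  row_free X -> X *m J *m X^T = 0 -> (X *m G <= X)%MS -> \det G = 1.
Proof.
move=> en; subst n => uJ GJG fX XJX XGX.
pose E := row_ebase X.
have uE : E \in unitmx := row_ebase_unit X.
have rX : \rank X = k by apply/eqP.
have EX : (usubmx E :=: X)%MS.
  have -> : usubmx E = pid_mx k *m E.
    by rewrite -[E in RHS]vsubmxK pid_mx_row mul_row_col mul1mx mul0mx addr0.
  by apply: eqmx_trans (eq_row_base X); rewrite /row_base rX.
have [A eA] : exists A, usubmx E *m G = A *m usubmx E.
  by apply/submxP; rewrite EX; apply: submx_trans XGX; rewrite submxMr // EX.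
have EJE : usubmx E *m J *m (usubmx E)^T = 0.
  have /submxP[D ->] : (usubmx E <= X)%MS by rewrite EX.
  by rewrite trmx_mul !mulmxA -(mulmxA D) -(mulmxA D) XJX mulmx0 mul0mx.
pose L := E *m G *m invmx E.
pose Q := E *m J *m E^T.
have uQ : Q \in unitmx by rewrite !unitmx_mul uE uJ unitmx_tr uE.
have LQL : L *m Q *m L^T = Q.
  have LE : L *m E = E *m G by rewrite /L mulmxKV.
  have -> : L *m Q *m L^T = (L *m E) *m J *m (L *m E)^T.
    by rewrite /Q (trmx_mul L E) !mulmxA.
  by rewrite LE trmx_mul !mulmxA -(mulmxA E G) -(mulmxA E (G *m J)) GJG.
have dL : \det L = \det G.
  by rewrite /L !det_mulmx det_inv mulrAC divrr ?mul1r.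
have eLu : usubmx L = row_mx A 0.
  rewrite -!mul_usub_mx eA -mulmxA mul_usub_mx mulmxV //.
  by rewrite (@scalar_mx_block _ k k) block_mxEv col_mxKu mul_mx_row mulmx1 mulmx0.
have eL : L = block_mx A 0 (dlsubmx L) (drsubmx L).
  by rewrite -[LHS]submxK /ulsubmx /ursubmx eLu row_mxKl row_mxKr.
have eQ : Q = block_mx 0 (ursubmx Q) (dlsubmx Q) (drsubmx Q).
  rewrite -[LHS]submxK; congr block_mx.
  by rewrite /ulsubmx -!mul_usub_mx -mulmx_lsub -trmx_usub.
set K := ursubmx Q in eQ.
(* A row vector killed by K, padded with zeros, is killed by the invertible [Q]. *)
have dK : \det K != 0.
  apply/det0P => -[v v0 vK]; move: v0; apply/negP; rewrite negbK.
  have : row_mx v 0 *m Q = 0.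
    by rewrite eQ mul_row_block vK !mul0mx mulmx0 !addr0 row_mx0.
  move/(canRL (mulmxK uQ)); rewrite mul0mx => /eqP.
  by rewrite row_mx_eq0 => /andP[].
(* The upper right block of [LQL] is the relation A K D^T = K. *)
have /(congr1 (@ursubmx _ k k k k)) := LQL.
rewrite eL eQ tr_block_mx !mulmx_block !block_mxKur.
rewrite !mulmx0 !mul0mx !addr0 mul0mx add0r.
move/(congr1 determinant); rewrite !det_mulmx det_tr mulrAC.
move/(canRL (mulfK dK)); rewrite divff // => AD.
by rewrite -dL eL det_lblock.
Qed.

(** * Coordinates, isometries and reflections for a symmetric form *)

Section Form.
Context {F : fieldType} {V : vectType F} (B : {symmetric V}).
Implicit Types (u v x y : V) (g h : 'End(V)) (U W S X Y : {vspace V}).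

Let n := \dim {:V}.
Let e := vbasis {:V}.
Let eP : basis_of {:V} e := vbasisP {:V}.

Lemma symC u v : B u v = B v u.
Proof. by rewrite hermC expr0 mul1r. Qed.

Definition gram_mx : 'M[F]_n := \matrix_(i, j) B e`_i e`_j.

Lemma form_gramE u v :
  B u v = (rVof e u *m gram_mx *m (rVof e v)^T) 0 0.
Proof.
rewrite {1}[u](coord_basis eP) ?memvf // {1}[v](coord_basis eP) ?memvf //.
rewrite linear_sumr mxE; apply: eq_bigr => j _.
rewrite linear_sumlz !mxE mulr_suml; apply: eq_bigr => i _.
by rewrite !mxE linearZr_LR linearZl_LR /= mulrC.
Qed.

Lemma mxof_row g (i : 'I_n) :
  row i (mxof e e g) = rVof e (g e`_i).
Proof. by rewrite rowE mul_mxof vecof_delta. Qed.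

Lemma mxof_isometry g : isometries B g ->
  mxof e e g *m gram_mx *m (mxof e e g)^T = gram_mx.
Proof.
case=> _ gB; apply/matrixP => i j; rewrite [RHS]mxE -gB form_gramE -!mxof_row.
by rewrite -row_mul tr_row -[row i _ *m _]row_mul !mxE; apply: eq_bigr => k _; rewrite !mxE.
Qed.

(** Encodes a subspace as a row space, so that inclusion and orthogonality become matrix
    statements. *)
Definition coord_mx X : 'M[F]_(\dim X, n) :=
  \matrix_i rVof e (vbasis X)`_i.

Lemma mul_coord_mx X (c : 'rV[F]_(\dim X)) :
  c *m coord_mx X = rVof e (\sum_i c 0 i *: (vbasis X)`_i).
Proof.
rewrite linear_sum mulmx_sum_row; apply: eq_bigr => i _.
by rewrite rowK linearZ.
Qed.

Lemma coord_mx_free X : row_free (coord_mx X).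
Proof.
apply: inj_row_free => c; rewrite mul_coord_mx => /eqP.
rewrite rVof_eq0 // => /eqP c0; apply/rowP => i; rewrite mxE.
by move/freeP: (basis_free (vbasisP X)) => /(_ _ c0 i).
Qed.

Lemma rVof_coord_mx X v : (rVof e v <= coord_mx X)%MS = (v \in X).
Proof.
apply/submxP/idP => [[c]|vX].
  rewrite mul_coord_mx => /(can_inj (rVofK eP)) ->.
  by apply: memv_suml => i _; rewrite memvZ // vbasis_mem // mem_nth // size_tuple.
exists (\row_i coord (vbasis X) i v); rewrite mul_coord_mx; congr rVof.
by rewrite [LHS](coord_vbasis vX); apply: eq_bigr => i _; rewrite mxE.
Qed.

Lemma coord_mx_ortho X Y :
  (coord_mx X *m gram_mx *m (coord_mx Y)^T == 0) = (X <= orthov B Y)%VS.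
Proof.
apply/eqP/orthovP => [XY u v|XY].
  rewrite -!rVof_coord_mx form_gramE => /submxP[c ->] /submxP[d ->].
  by rewrite trmx_mul !mulmxA -(mulmxA c) -(mulmxA c) XY mulmx0 mul0mx mxE.
apply/matrixP => i j; rewrite [RHS]mxE.
have uX : (vbasis X)`_i \in X by rewrite vbasis_mem // mem_nth // size_tuple.
have vY : (vbasis Y)`_j \in Y by rewrite vbasis_mem // mem_nth // size_tuple.
rewrite -(XY _ _ uX vY) form_gramE.
rewrite -[rVof e (vbasis X)`_i](rowK (fun i => rVof e (vbasis X)`_i)).
rewrite -[rVof e (vbasis Y)`_j](rowK (fun i => rVof e (vbasis Y)`_i)).
by rewrite tr_row -row_mul -row_mul !mxE; apply: eq_bigr => k _; rewrite !mxE.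
Qed.

Hypothesis ndB : nondegenerate B.

Lemma gram_mx_unit : gram_mx \in unitmx.
Proof.
rewrite -row_free_unit; apply: inj_row_free => c cJ0; apply/eqP.
rewrite -(vecof_eq0 eP) -memv0 -(eqP ndB); apply/mem_orthovP => v _.
by rewrite form_gramE vecofK // cJ0 mul0mx mxE.
Qed.

(** In coordinates the orthogonal of [X] is the left kernel of [gram_mx *m (coord_mx X)^T], whose
    rank is [\dim X] because the Gram matrix is invertible. *)
Lemma dim_orthov X : \dim (orthov B X) = (n - \dim X)%N.
Proof.
set K := kermx (gram_mx *m (coord_mx X)^T).
have rK : \rank K = (n - \dim X)%N.
  rewrite mxrank_ker eqmxMfull ?row_full_unit ?gram_mx_unit //.
  by rewrite mxrank_tr (eqP (coord_mx_free X)).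
have <- := rK.
rewrite -[LHS](eqP (coord_mx_free _)); apply/eqP.
rewrite eqn_leq !mxrankS //.
  apply/row_subP => i.
  rewrite -[row i K](vecofK eP) rVof_coord_mx.
  apply/mem_orthovP => v; rewrite -rVof_coord_mx form_gramE.
  move=> /submxP[c ->].
  rewrite vecofK // trmx_mul !mulmxA -[_ *m _ *m (coord_mx X)^T]mulmxA.
  by rewrite -row_mul mulmx_ker row0 mul0mx mxE.
apply/sub_kermxP/eqP; rewrite mulmxA coord_mx_ortho.
exact: subvv.
Qed.

Lemma isometry_lker0 g : (forall u v, B (g u) (g v) = B u v) -> lker g = 0%VS.
Proof.
move=> gB; apply/eqP; rewrite -subv0 -(eqP ndB); apply/subvP => x.
rewrite memv_ker => /eqP gx; apply/mem_orthovP => y _.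
by rewrite -gB gx linear0l.
Qed.

Lemma isometries_comp g h :
  isometries B g -> isometries B h -> isometries B (g \o h)%VF.
Proof.
move=> [_ gB] [_ hB].
have ghB u v : B ((g \o h)%VF u) ((g \o h)%VF v) = B u v.
  by rewrite !comp_lfunE gB hB.
by split=> //; apply: isometry_lker0.
Qed.

Lemma isometries_inv g : isometries B g -> isometries B (g^-1)%VF.
Proof.
move=> [/eqP g0 gB].
have gVB u v : B ((g^-1)%VF u) ((g^-1)%VF v) = B u v.
  by rewrite -gB !lker0_lfunVK.
by split=> //; apply: isometry_lker0.
Qed.

Lemma lfun_det_id : lfun_det (\1%VF : 'End(V)) = 1.
Proof. by rewrite /lfun_det mxof1 ?det1 // (basis_free eP). Qed.

Lemma lfun_det_comp g h : lfun_det (g \o h)%VF = lfun_det g * lfun_det h.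
Proof. by rewrite /lfun_det (mxof_comp _ _ eP) det_mulmx mulrC. Qed.

Lemma lfun_det_isometry g : isometries B g -> lfun_det g = 1 \/ lfun_det g = -1.
Proof.
move/mxof_isometry/(congr1 determinant).
rewrite !det_mulmx det_tr mulrAC -expr2 => h.
have /eqP : lfun_det g ^+ 2 = 1.
  by apply: (mulIf (x := \det gram_mx)); rewrite ?mul1r // -unitfE -unitmxE gram_mx_unit.
by rewrite sqrf_eq1 => /orP[]/eqP; [left|right].
Qed.

Lemma lfun_det_stable_lagrangian g M : isometries B g ->
  (M <= orthov B M)%VS -> n = (\dim M + \dim M)%N -> (g @: M <= M)%VS ->
  lfun_det g = 1.
Proof.
move=> gI MM dM gM.
apply: (det_isometry_stable_lagrangian dM gram_mx_unit (mxof_isometry gI)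
  (coord_mx_free M)); first by apply/eqP; rewrite coord_mx_ortho.
apply/row_subP => i; rewrite row_mul rowK -(rVof_app _ eP) rVof_coord_mx.
by rewrite (subvP gM) // memv_img // vbasis_mem // mem_nth // size_tuple.
Qed.

(** For isotropic [u] the division by zero yields zero and the map is the identity; only
    [B u u != 0] gives a true reflection. *)
Definition reflection_fun u x := x - (2 * B x u / B u u) *: u.

Fact reflection_fun_linear u : linear (reflection_fun u).
Proof.
move=> a x y; rewrite /reflection_fun linearDl linearZl_LR /=.
rewrite mulrDr mulrDl scalerDl opprD addrACA scalerBr scalerA; congr (_ - _ *: _ + _).
by rewrite mulrCA !mulrA.
Qed.

HB.instance Definition _ u := GRing.isSemilinear.Build F _ _ _ (reflection_fun u)
  (GRing.semilinear_linear (reflection_fun_linear u)).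

Definition reflection u : 'End(V) := linfun (reflection_fun u).

Lemma reflectionE u x : reflection u x = x - (2 * B x u / B u u) *: u.
Proof. by rewrite lfunE. Qed.

Lemma reflection_fix u x : B x u = 0 -> reflection u x = x.
Proof. by move=> xu; rewrite reflectionE xu mulr0 mul0r scale0r subr0. Qed.

Lemma reflection_isometry u : B u u != 0 -> isometries B (reflection u).
Proof.
move=> uu; have h x y : B (reflection u x) (reflection u y) = B x y.
  rewrite !reflectionE linearBl /= !linearBr /= !linearZl_LR !linearZr_LR /=.
  rewrite (symC u y); set a := B x u; set b := B y u; set c := B u u in uu *.
  by field.
by split=> //; apply: isometry_lker0.
Qed.

Lemma lfun_det_reflection u : B u u != 0 -> lfun_det (reflection u) = -1.
Proof.
move=> uu; rewrite /lfun_det.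
have -> : mxof (vbasis {:V}) (vbasis {:V}) (reflection u) =
    1%:M + (\col_i (- (2 * B e`_i u / B u u))) *m rVof e u.
  apply/row_matrixP => i; rewrite mxof_row linearD /= row1 row_mul reflectionE.
  rewrite linearB linearZ /= rVofE //; congr (_ + _).
  by apply/rowP => j; rewrite !mxE big_ord1 !mxE mulNr.
rewrite det_1D_mul_col_row.
(* By linearity the entries reassemble into [- (2 * B u u / B u u)]. *)
have -> : (rVof e u *m \col_i (- (2 * B e`_i u / B u u))) 0 0 = - 2.
  rewrite mxE; transitivity (- (2 * B (\sum_i coord e i u *: e`_i) u / B u u)).
    rewrite linear_sumlz mulr_sumr mulr_suml -sumrN; apply: eq_bigr => i _.
    by rewrite !mxE linearZl_LR /=; field.
  by rewrite -(coord_basis eP) ?memvf // mulfK.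
by ring.
Qed.

End Form.

(** * Splitting an orbit under the determinant-one subgroup *)

Section Orbits.
Local Notation orbit := Defs.orbit.
Context {F : fieldType} {V : vectType F} (B : {symmetric V}).
Implicit Types (g h k : 'End(V)) (S T : {vspace V}).

Hypothesis ndB : nondegenerate B.
Variable H : set 'End(V).
Hypothesis H_isometries : H `<=` isometries B.
Hypothesis H_comp : forall g h, H g -> H h -> H (g \o h)%VF.
Hypothesis H_inv : forall g, H g -> H (g^-1)%VF.

Let K := H `&` special_isometries B.

Lemma mem_special g : H g -> lfun_det g = 1 -> K g.
Proof. by move=> Hg dg; split=> //; split=> //; exact: H_isometries. Qed.

Lemma H_lker0 g : H g -> lker g == 0%VS.
Proof. by move=> /H_isometries[->]. Qed.

Lemma limg_lfunVK_isometry g S : H g -> (g^-1 @: (g @: S))%VS = S.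
Proof. by move=> /H_lker0 g0; rewrite -limg_comp lker0_compVf // lim1g. Qed.

Lemma lfun_det_inv g : H g -> lfun_det g * lfun_det (g^-1)%VF = 1.
Proof.
by move=> /H_lker0 g0; rewrite -lfun_det_comp lker0_compfV // lfun_det_id.
Qed.

Lemma special_comp g h : K g -> K h -> K (g \o h)%VF.
Proof.
move=> [Hg [_ /= dg]] [Hh [_ /= dh]].
by apply: mem_special; [exact: H_comp|rewrite lfun_det_comp dg dh mulr1].
Qed.

Lemma special_inv g : K g -> K (g^-1)%VF.
Proof.
move=> [Hg [_ /= dg]]; apply: mem_special; first exact: H_inv.
by have := lfun_det_inv Hg; rewrite dg mul1r.
Qed.

Lemma orbit_special g S : K g -> orbit K (g @: S)%VS = orbit K S.
Proof.
move=> Kg; apply/seteqP; split=> [_ [k Kk <-]|_ [k Kk <-]].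
  by exists (k \o g)%VF; [exact: special_comp|rewrite limg_comp].
exists (k \o g^-1)%VF; first by apply: special_comp => //; exact: special_inv.
by rewrite limg_comp limg_lfunVK_isometry //; case: Kg.
Qed.

Lemma special_id g : H g -> K \1%VF.
Proof.
move=> Hg; apply: mem_special; last exact: lfun_det_id.
by rewrite -(lker0_compVf (H_lker0 Hg)); apply: H_comp => //; exact: H_inv.
Qed.

Variables (S : {vspace V}) (s : 'End(V)).
Hypotheses (Hs : H s) (det_s : lfun_det s = -1).

(** An element [g] of [H] of determinant 1 keeps [S] in its [K]-orbit. One of determinant -1 factors
    as [g \o s^-1], which lies in [K], after [s]. The two listed orbits may coincide. *)
Lemma special_orbits :
  [set orbit K T | T in orbit H S] = [set orbit K S; orbit K (s @: S)%VS].
Proof.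
apply/seteqP; split=> [_ [_ [g Hg <-] <-]|_ [->|->]].
- have [dg|dg] := lfun_det_isometry ndB (H_isometries Hg).
    by left; apply: orbit_special; exact: mem_special.
  right; rewrite -(@orbit_special (g \o s^-1)%VF).
    by rewrite -limg_comp -comp_lfunA lker0_compVf ?H_lker0 // comp_lfun1r.
  apply: mem_special; first by apply: H_comp => //; exact: H_inv.
  rewrite lfun_det_comp dg; have := lfun_det_inv Hs.
  by rewrite det_s !mulN1r.
- exists S => //; exists \1%VF; last by rewrite lim1g.
  by case: (special_id Hs).
- by exists (s @: S)%VS => //; exists s.
Qed.

(** Since [g] fixes [S], the image of [S] under [s] is also its image under [s \o g], which has
    determinant 1; the two orbits coincide. *)
Lemma decomposes_into_1 g :
  H g -> (g @: S)%VS = S -> lfun_det g = -1 -> decomposes_into 1 K (orbit H S).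
Proof.
move=> Hg gS dg; rewrite /decomposes_into special_orbits.
suff -> : orbit K (s @: S)%VS = orbit K S by rewrite setUid; exact: card_set1.
rewrite -{1}gS -limg_comp; apply: orbit_special.
by apply: mem_special; [exact: H_comp|rewrite lfun_det_comp det_s dg mulrNN mulr1].
Qed.

Lemma decomposes_into_2 :
  (forall g, H g -> (g @: S)%VS = S -> lfun_det g <> -1) ->
  decomposes_into 2 K (orbit H S).
Proof.
move=> stabS; rewrite /decomposes_into special_orbits.
have neq : orbit K S <> orbit K (s @: S)%VS.
  move=> eqS; have : orbit K (s @: S)%VS (s @: S)%VS.
    by exists \1%VF; [exact: special_id Hs|rewrite lim1g].
  (* If the orbits coincide, some [k] in [K] sends [S] where [s] does, and [k^-1 \o s] is a
     stabilizing element of determinant -1. *)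
  rewrite -eqS => -[k Kk kS].
  have [Hk [_ /= dk]] := special_inv Kk.
  apply: (stabS (k^-1 \o s)%VF); first exact: H_comp.
    by rewrite limg_comp -kS limg_lfunVK_isometry //; case: Kk.
  by rewrite lfun_det_comp dk det_s mul1r.
apply/eq_cardSP; exists (orbit K S); first by left.
suff -> : [set orbit K S; orbit K (s @: S)%VS] `\ orbit K S =
    [set orbit K (s @: S)%VS] by exact: card_set1.
by apply/seteqP; split=> [_ [[->|->] /= ne]|_ ->] //=; split; [right|apply/nesym].
Qed.

End Orbits.

(** * Projections of a subspace to two complementary summands *)

Section Projections.
Context {F : fieldType} {V : vectType F} (U W : {vspace V}).
Implicit Types S : {vspace V}.

Hypotheses (UaddW : (U + W)%VS = {:V}%VS) (UcapW : (U :&: W)%VS = 0%VS).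

Let n := \dim {:V}.

Lemma dim_summands : n = (\dim U + \dim W)%N.
Proof. by rewrite /n -UaddW dimv_disjoint_sum. Qed.

(** This is rank-nullity for the projection of [S] to [U], whose kernel is [S :&: W]; it is obtained
    by counting dimensions of sums and intersections. *)
Lemma dim_proj_along S : (\dim (proj_along W U S) + \dim (S :&: W))%N = \dim S.
Proof.
have := dimv_sum_cap (S + W)%VS U; have := dimv_sum_cap S W.
rewrite -/(proj_along W U S) -addvA (addvC W) UaddW addvf -/n dim_summands.
lia.
Qed.

Lemma sub_proj_along S : (S <= proj_along W U S + proj_along U W S)%VS.
Proof.
apply/subvP => x xS.
have /memv_addP[u uU [w wW xE]] : x \in (U + W)%VS by rewrite UaddW memvf.
rewrite xE; apply: memv_add; rewrite /proj_along memv_cap ?uU ?wW andbT.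
- have -> : u = x - w by rewrite xE addrK.
  by apply: memv_add => //; rewrite memvN.
- have -> : w = x - u by rewrite xE addrC addKr.
  by apply: memv_add => //; rewrite memvN.
Qed.

Lemma proj_alongS S : (proj_along W U S <= U)%VS.
Proof. exact: capvSr. Qed.

End Projections.

(** * The group [H] and the room left around a projection in its summand *)

Section OrthogonalSum.
Context {F : fieldType} {V : vectType F} (B : {symmetric V}).
Implicit Types (g : 'End(V)) (S U W : {vspace V}).

Hypothesis ndB : nondegenerate B.

(** Pairs of isometries glue because the cross terms vanish, and nondegeneracy makes the result
    injective. Conversely an isometry stabilizing both summands restricts to each. The right-hand
    form is the convenient one for composition, inverses and reflections. *)
Lemma product_isometriesP U W g :
  (U + W)%VS = {:V}%VS -> (U :&: W)%VS = 0%VS -> (U <= orthov B W)%VS ->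
  product_isometries B U W g <->
  [/\ isometries B g, (g @: U <= U)%VS & (g @: W <= W)%VS].
Proof.
move=> UaddW UcapW /orthovP UW.
have UW' (u : subvs_of U) (w : subvs_of W) : B (vsval u) (vsval w) = 0.
  by rewrite UW ?subvsP.
have WU' (u : subvs_of U) (w : subvs_of W) : B (vsval w) (vsval u) = 0.
  by rewrite symC UW'.
split=> [[gU [gW [[_ gUB] [_ gWB] gE]]]|[[/eqP/lker0P g_inj gB] gU gW]].
  have gEU (u : subvs_of U) : g (vsval u) = vsval (gU u).
    by have := gE u 0; rewrite !linear0 !addr0.
  have gEW (w : subvs_of W) : g (vsval w) = vsval (gW w).
    by have := gE 0 w; rewrite !linear0 !add0r.
  have gI x y : B (g x) (g y) = B x y.
    have /memv_addP[u uU [w wW ->]] : x \in (U + W)%VS by rewrite UaddW memvf.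
    have /memv_addP[u' uU' [w' wW' ->]] : y \in (U + W)%VS by rewrite UaddW memvf.
    rewrite -(vsprojK uU) -(vsprojK uU') -(vsprojK wW) -(vsprojK wW') !gE.
    rewrite !linearDl /= !linearDr /=.
    have := gUB (vsproj U u) (vsproj U u'); rewrite /restrict_form => ->.
    have := gWB (vsproj W w) (vsproj W w'); rewrite /restrict_form => ->.
    by rewrite !UW' !WU'.
  split; first by split=> //; exact: (isometry_lker0 ndB).
  - apply/subvP => _ /memv_imgP[u uU ->].
    by rewrite -(vsprojK uU) gEU subvsP.
  - apply/subvP => _ /memv_imgP[w wW ->].
    by rewrite -(vsprojK wW) gEW subvsP.
have restr X : (g @: X <= X)%VS -> exists2 h : 'End(subvs_of X),
    isometries (restrict_form B (X := X)) h &
    forall x : subvs_of X, g (vsval x) = vsval (h x).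
  move=> gX.
  (* The restriction of [g] to [X]; the projection [vsproj] changes nothing since [g] maps [X] into
     [X]. *)
  pose h := (linfun (vsproj X) \o (g \o linfun vsval))%VF : 'End(subvs_of X).
  have hE x : vsval (h x) = g (vsval x).
    rewrite !comp_lfunE !lfunE /= vsprojK //.
    by rewrite (subvP gX) // memv_img // subvsP.
  exists h => //; split; last by move=> u v; rewrite /restrict_form !hE gB.
  apply/eqP/lker0P => x y hxy; apply: subvs_inj.
  by apply: g_inj; rewrite -!hE hxy.
have [gU' gU'I gU'E] := restr _ gU; have [gW' gW'I gW'E] := restr _ gW.
by exists gU', gW'; split=> // u w; rewrite linearD /= gU'E gW'E.
Qed.

Variables U W : {vspace V}.
Hypotheses (UaddW : (U + W)%VS = {:V}%VS) (UcapW : (U :&: W)%VS = 0%VS).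
Hypothesis UperpW : (U <= orthov B W)%VS.

Let n := \dim {:V}.

(** The radical of P lies in the orthogonal of [W + P], of dimension [\dim U - \dim P]. *)
Lemma dim_proj_Rad_le S :
  (\dim (proj_along W U S) + \dim (Rad B (proj_along W U S)) <= \dim U)%N.
Proof.
set P := proj_along W U S.
have PW : (W :&: P = 0)%VS.
  by apply/eqP; rewrite -subv0 -UcapW capvC capvS // proj_alongS.
have RWP : (Rad B P <= orthov B (W + P))%VS.
  rewrite orthovD capvSr andbT; apply: subv_trans UperpW.
  by apply: subv_trans (capvSl _ _) _; exact: proj_alongS.
have := dimvS RWP; rewrite dim_orthov // dimv_disjoint_sum // (dim_summands UaddW UcapW).
have := dimvS (proj_alongS U W S); rewrite -/P.
lia.
Qed.

Hypothesis two_neq0 : 2 != 0 :> F.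

(** [D] is the orthogonal of [P] inside [U]. If all its vectors were isotropic, [D] would lie in its
    own orthogonal [W + P], hence in [P] as it lies in [U], hence in [Rad B P]; but its dimension
    [\dim U - \dim P] is too large for that. *)
Lemma exists_anisotropic S :
  (\dim (proj_along W U S) + \dim (Rad B (proj_along W U S)) < \dim U)%N ->
  exists u, [/\ u \in U, u \in orthov B (proj_along W U S) & B u u != 0].
Proof.
set P := proj_along W U S => ltU.
have PU : (P <= U)%VS := proj_alongS U W S.
have PW : (W :&: P = 0)%VS.
  by apply/eqP; rewrite -subv0 -UcapW capvC capvS.
pose D := orthov B (W + P).
have dWP : \dim (W + P) = (\dim W + \dim P)%N by rewrite dimv_disjoint_sum.
have DU : (D <= U)%VS.
  have -> : U = orthov B W.
    by apply/eqP; rewrite eqEdim UperpW dim_orthov // (dim_summands UaddW UcapW) addnK leqnn.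
  by have := subvv D; rewrite {2}/D orthovD => /andP[].
have DP : (D <= orthov B P)%VS.
  by have := subvv D; rewrite {2}/D orthovD => /andP[].
have [[u uD uu]|iso] := pselect (exists2 u, u \in D & B u u != 0).
  by exists u; split=> //; [exact: (subvP DU)|exact: (subvP DP)].
have Duu u : u \in D -> B u u = 0.
  by move=> uD; apply/eqP/negPn/negP => uu; apply: iso; exists u.
(* Polarization: for isotropic [u], [v] and [u + v], [2 * B u v] vanishes, and 2 is nonzero. *)
have DD : (D <= orthov B D)%VS.
  apply/orthovP => u v uD vD; have := Duu _ (memvD uD vD).
  rewrite linearDl /= !linearDr /= !Duu // add0r addr0 (symC B v).
  by rewrite -mulr2n -mulr_natl => /eqP; rewrite mulf_eq0 (negPf two_neq0) => /eqP.
have WPD : (W + P)%VS = orthov B D.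
  apply/eqP; rewrite eqEdim orthov_sym subvv !dim_orthov //.
  by rewrite subKn // dimvS // subvf.
have DP' : (D <= P)%VS.
  apply/subvP => x xD; move: (subvP DD _ xD); rewrite -WPD.
  move=> /memv_addP[w wW [p pP xE]]; rewrite xE.
  have : w \in (U :&: W)%VS.
    rewrite memv_cap wW andbT (_ : w = x - p); last by rewrite xE addrK.
    exact: (memvB (subvP DU _ xD) (subvP PU _ pP)).
  by rewrite UcapW memv0 => /eqP ->; rewrite add0r.
have := dimvS (_ : (D <= Rad B P)%VS); rewrite subv_cap DP' DP => /(_ isT).
rewrite /D dim_orthov // dWP (dim_summands UaddW UcapW).
by have := dimvS PU; lia.
Qed.

End OrthogonalSum.

(** * The isotropic subspace obtained by adding the radical of a projection *)

Section Lagrangian.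
Context {F : fieldType} {V : vectType F} (B : {symmetric V}).
Implicit Types (g : 'End(V)) (S U W : {vspace V}).

(** [S] lies in the sum of its two projections; the radical is orthogonal to the one in [U] by
    definition and to the one in [W] because it lies in [U]. *)
Lemma Rad_proj_along_ortho U W S :
  (U + W)%VS = {:V}%VS -> (U <= orthov B W)%VS ->
  (Rad B (proj_along W U S) <= orthov B S)%VS.
Proof.
move=> UaddW UperpW; rewrite orthov_sym.
apply: subv_trans (sub_proj_along UaddW S) _; rewrite orthov_sym orthovD.
rewrite capvSr /=; apply: subv_trans (capvSl _ _) _.
apply: subv_trans (proj_alongS _ _ _) _; apply: subv_trans UperpW _.
by rewrite orthov_sym; apply: subv_trans (proj_alongS _ _ _) _; rewrite orthov_sym subvv.
Qed.

Lemma add_Rad_isotropic U W S :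
  (U + W)%VS = {:V}%VS -> (U <= orthov B W)%VS -> (S <= orthov B S)%VS ->
  (S + Rad B (proj_along W U S) <= orthov B (S + Rad B (proj_along W U S)))%VS.
Proof.
move=> UaddW UperpW SS; have RS := Rad_proj_along_ortho S UaddW UperpW.
rewrite orthoDv !orthovD SS RS orthov_sym RS /=.
apply: subv_trans (capvSr _ _) _; rewrite orthov_sym.
by apply: subv_trans (capvSl _ _) _; rewrite orthov_sym.
Qed.

(** The radical meets [S] exactly in [S :&: U]. Hence the sum has dimension [\dim S + a_inv U W S],
    that is r + a. *)
Lemma dim_add_Rad U W S : (U <= orthov B W)%VS -> (S <= orthov B S)%VS ->
  (\dim (S + Rad B (proj_along W U S)) + \dim (S :&: U) =
   \dim S + \dim (Rad B (proj_along W U S)))%N.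
Proof.
move=> UperpW SS; rewrite -(dimv_sum_cap S); congr (_ + \dim _)%N.
apply/eqP; rewrite eqEsubv subv_cap capvSl capv_sub_Rad //=.
by rewrite capvS // (subv_trans (capvSl _ _)) // proj_alongS.
Qed.

(* For s = u + w in S with u in Rad (P_U S), w = s - u is orthogonal to P_W S
   because s is orthogonal to S and u to P_U S. *)
Lemma add_Rad_sub U W S :
  (U + W)%VS = {:V}%VS -> (U <= orthov B W)%VS -> (S <= orthov B S)%VS ->
  (S + Rad B (proj_along W U S) <= S + Rad B (proj_along U W S))%VS.
Proof.
move=> UaddW UperpW SS; apply/subvP => _ /memv_addP[t tS [u uR ->]].
have uU : u \in U by apply: (subvP (proj_alongS U W S)); apply: (subvP (capvSl _ _) _ uR).
have : u \in proj_along W U S by apply: (subvP (capvSl _ _) _ uR).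
rewrite memv_cap uU andbT => /memv_addP[s sS [w wW uE]].
have -> : t + u = (t + s) + w by rewrite uE addrA.
apply: memv_add; first exact: memvD.
rewrite memv_cap memv_cap wW andbT; apply/andP; split.
  by rewrite (_ : w = - s + u) ?memv_add ?memvN // uE addKr.
apply/mem_orthovP => w' w'P.
have : w' \in proj_along U W S by [].
rewrite memv_cap => /andP[/memv_addP[s' s'S [u' u'U w'E]] w'W].
have uw' : B u w' = 0 by move/orthovP: UperpW; apply.
have su' : B u s' = 0.
  by move/orthovP: (Rad_proj_along_ortho S UaddW UperpW); apply.
have ss' : B s s' = 0 by move/orthovP: SS; apply.
have wu' : B w u' = 0 by rewrite symC; move/orthovP: UperpW; apply.
have wE : w = u - s by rewrite uE addrC addKr.
by rewrite w'E linearDr /= wu' addr0 wE linearBl /= su' ss' subr0.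
Qed.

(** The projection is built from [S], [U] and [W], all preserved by [g], and an isometry preserves
    the radical of a subspace that it maps onto itself. *)
Lemma add_Rad_stable U W S g : isometries B g -> (g @: U <= U)%VS ->
  (g @: W <= W)%VS -> (g @: S)%VS = S ->
  (g @: (S + Rad B (proj_along W U S)) <= S + Rad B (proj_along W U S))%VS.
Proof.
move=> [/eqP g0 gB] gU gW gS; set P := proj_along W U S.
rewrite limgD gS addvS //.
have gPle : (g @: P <= P)%VS.
  apply: subv_trans (limg_cap _ _ _) _; apply: capvS => //.
  by rewrite limgD gS addvS.
(* Equality is needed below: a vector of [P] is tested against the image of the radical by writing
   it as an image under [g]. *)
have gP : (g @: P)%VS = P.
  apply/eqP; rewrite eqEdim gPle limg_dim_eq ?leqnn //.
  by rewrite (eqP g0) capv0.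
apply: subv_trans (limg_cap _ _ _) _; apply: capvS => //.
apply/orthovP => _ y /memv_imgP[x xP ->]; rewrite -{1}gP => /memv_imgP[z zP ->].
by rewrite gB; move/mem_orthovP: xP; apply.
Qed.

End Lagrangian.

(** * The decomposition theorem over a field where 2 is nonzero *)

Lemma orbit_decomposition (F : fieldType) (n m r : nat) (V : vectType F)
    (B : {symmetric V}) (U W : {vspace V})
    (two_neq0 : 2 != 0 :> F) (dimV : \dim {:V} = n) (ndB : nondegenerate B)
    (UaddW : (U + W)%VS = {:V}%VS) (UcapW : (U :&: W)%VS = 0%VS)
    (UperpW : (U <= orthov B W)%VS)
    (dimU : \dim U = m) (dimW : \dim W = (n - m)%N)
    (m_gt0 : (0 < m)%N) (m_ltn : (m < n)%N) (r_le : (r <= n./2)%N)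
    (H : set 'End(V)) (defH : H = product_isometries B U W)
    (G0 : set 'End(V)) (defG0 : G0 = special_isometries B)
    (rU rW a b : nat) (O : set {vspace V})
    (orbO : orbit_with_invariants B H U W r rU rW a b O) :
  (decomposes_into 1 (H `&` G0) O \/ decomposes_into 2 (H `&` G0) O)
  /\ (decomposes_into 2 (H `&` G0) O <->
        (2 * rU + 2 * a + b = m)%N /\ (2 * rW + 2 * a + b = n - m)%N)
  /\ ((2 * rU + 2 * a + b = m)%N /\ (2 * rW + 2 * a + b = n - m)%N <->
        (2 * (r + a) = n)%N).
Proof.
have WaddU : (W + U)%VS = {:V}%VS by rewrite addvC.
have WcapU : (W :&: U)%VS = 0%VS by rewrite capvC.
have WperpU : (W <= orthov B U)%VS by rewrite orthov_sym.
case: orbO => S [[dimS SS] [<- <- <- <-] ->] {rU rW a b}.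
have HP g := product_isometriesP ndB g UaddW UcapW UperpW.
pose P := proj_along W U S; pose Q := proj_along U W S.
have rP : (\dim P + \dim (S :&: W))%N = r by rewrite -dimS; exact: (dim_proj_along UaddW UcapW).
have rQ : (\dim Q + \dim (S :&: U))%N = r by rewrite -dimS; exact: (dim_proj_along WaddU WcapU).
have leP : (\dim P + \dim (Rad B P) <= m)%N.
  by rewrite -dimU; exact: (dim_proj_Rad_le ndB UaddW UcapW UperpW).
have leQ : (\dim Q + \dim (Rad B Q) <= n - m)%N.
  by rewrite -dimW; exact: (dim_proj_Rad_le ndB WaddU WcapU WperpU).
have dM := dim_add_Rad UperpW SS; have dM' := dim_add_Rad WperpU SS.
(* Comparing the dimensions of both descriptions shows that [Q] yields the same value of a as [P];
   this is what makes [eqnm] and [eqn] hold. *)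
have MM' : (S + Rad B P)%VS = (S + Rad B Q)%VS.
  by apply/eqP; rewrite eqEsubv !add_Rad_sub.
rewrite -/P -/Q dimS in dM dM'; rewrite -MM' in dM'.
have le1 : (\dim (S :&: U) <= \dim (Rad B P))%N by apply: dimvS; apply: capv_sub_Rad.
have le2 : (\dim (Rad B P) <= \dim P)%N by rewrite dimvS // capvSl.
have le3 : (\dim (S :&: W) <= \dim (Rad B Q))%N by apply: dimvS; apply: capv_sub_Rad.
rewrite /a_inv /b_inv -/P.
set a := (\dim (Rad B P) - \dim (S :&: U))%N.
set b := (\dim P - \dim (Rad B P))%N.
have eqm : (2 * \dim (S :&: U) + 2 * a + b = \dim P + \dim (Rad B P))%N.
  by rewrite /a /b; lia.
have eqnm : (2 * \dim (S :&: W) + 2 * a + b = \dim Q + \dim (Rad B Q))%N.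
  by rewrite /a /b; lia.
have eqn : (2 * (r + a) = (\dim P + \dim (Rad B P)) + (\dim Q + \dim (Rad B Q)))%N.
  by rewrite /a; lia.
(* The two left-hand sides are bounded by [m] and [n - m] and add up to [2 * (r + a)], so this
   equals [n] exactly when both bounds are attained. *)
have iii : (2 * \dim (S :&: U) + 2 * a + b = m)%N /\
    (2 * \dim (S :&: W) + 2 * a + b = n - m)%N <-> (2 * (r + a) = n)%N.
  by rewrite eqm eqnm eqn; lia.
have H_isom : H `<=` isometries B by move=> g; rewrite defH => /HP[].
have H_comp g h : H g -> H h -> H (g \o h)%VF.
  rewrite defH => /HP[gB gU gW] /HP[hB hU hW]; apply/HP.
  split; first exact: isometries_comp.
  - by rewrite limg_comp (subv_trans (limgS _ hU)).
  - by rewrite limg_comp (subv_trans (limgS _ hW)).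
have H_inv g : H g -> H (g^-1)%VF.
  rewrite defH => /HP[gB gU gW]; apply/HP.
  have g0 : lker g == 0%VS by case: gB => ->.
  have stab X : (g @: X <= X)%VS -> (g^-1 @: X <= X)%VS.
    move=> gX; have gXE : (g @: X)%VS = X.
      by apply/eqP; rewrite eqEdim gX limg_dim_eq ?leqnn // (eqP g0) capv0.
    by rewrite -{1}gXE -limg_comp lker0_compVf // lim1g.
  by split; [exact: isometries_inv|exact: stab|exact: stab].
have reflU u : u \in U -> B u u != 0 -> H (reflection B u).
  move=> uU uu; rewrite defH; apply/HP; split; first exact: reflection_isometry.
  - apply/subvP => _ /memv_imgP[x xU ->].
    by rewrite reflectionE memvB // memvZ.
  - apply/subvP => _ /memv_imgP[x xW ->].
    by rewrite reflection_fix //; move/orthovP: WperpU; apply.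
have reflW u : u \in W -> B u u != 0 -> H (reflection B u).
  move=> uW uu; rewrite defH; apply/HP; split; first exact: reflection_isometry.
  - apply/subvP => _ /memv_imgP[x xU ->].
    by rewrite reflection_fix //; move/orthovP: UperpW; apply.
  - apply/subvP => _ /memv_imgP[x xW ->].
    by rewrite reflectionE memvB // memvZ.
(* For the zero subspace the strict inequality reads [0 < m], so [U] contains an anisotropic vector;
   its reflection [s] is the element of determinant -1 in [H] that the orbit count requires. *)
have [e [eU We]] : exists e, e \in U /\ B e e != 0.
  have P0 : proj_along W U 0 = 0%VS by rewrite /proj_along add0v capvC.
  have [|u [uU _ uu]] := exists_anisotropic ndB UaddW UcapW UperpW two_neq0 (S := 0%VS).
    by rewrite P0 /Rad cap0v dimv0 dimU.
  by exists u.
set s := reflection B e.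
have -> : H `&` G0 = H `&` special_isometries B by rewrite defG0.
have Hs := reflU _ eU We; have ds := lfun_det_reflection We.
(* Here [S + Rad B P] is isotropic of dimension r + a = n/2 and stable under [g], so [g] has
   determinant 1, which differs from -1 as 2 is nonzero. *)
have stab1 g : (2 * (r + a) = n)%N -> H g -> (g @: S)%VS = S -> lfun_det g <> -1.
  move=> ran Hg gS; have := Hg; rewrite defH => /HP[gB gU gW].
  rewrite (lfun_det_stable_lagrangian ndB gB (add_Rad_isotropic UaddW UperpW SS)).
  - by move=> /eqP; rewrite -addr_eq0; apply/negP.
  - by rewrite dimV -/P; move: ran; rewrite /a; lia.
  - exact: add_Rad_stable.
(* Now one of the two bounds is strict, and the corresponding summand provides a reflection fixing
   [S] pointwise. *)
have stab2 : (2 * (r + a))%N <> n ->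
    exists g, [/\ H g, (g @: S)%VS = S & lfun_det g = -1].
  move=> ran; suff [u [Hu us uu]] : exists u, [/\ H (reflection B u),
      (S <= orthov B <[u]>)%VS & B u u != 0].
    exists (reflection B u); split=> //; last exact: lfun_det_reflection.
    rewrite -[RHS]lim1g; apply: eq_in_limg => x xS; rewrite id_lfunE reflection_fix //.
    by apply/eqP; rewrite -mem_orthov1 (subvP us).
  have SPQ u : u \in orthov B P -> u \in orthov B Q -> (S <= orthov B <[u]>)%VS.
    move=> uP uQ; apply: subv_trans (sub_proj_along UaddW S) _.
    by rewrite orthoDv -!mem_orthov_sym uP uQ.
  have [ltP|geP] := ltnP (\dim P + \dim (Rad B P)) m.
    rewrite -dimU in ltP.
    have [u [uU uP uu]] := exists_anisotropic ndB UaddW UcapW UperpW two_neq0 ltP.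
    exists u; split=> //; first exact: reflU.
    (* Orthogonality to [Q] is automatic, since [u] lies in [U] and [Q] in [W]. *)
    apply: SPQ => //; apply: (subvP _ _ uU); rewrite orthov_sym.
    by apply: subv_trans WperpU; exact: capvSr.
  have ltQ : (\dim Q + \dim (Rad B Q) < \dim W)%N by rewrite dimW; lia.
  have [u [uW uQ uu]] := exists_anisotropic ndB WaddU WcapU WperpU two_neq0 ltQ.
  exists u; split=> //; first exact: reflW.
  apply: SPQ => //; apply: (subvP _ _ uW); rewrite orthov_sym.
  by apply: subv_trans UperpW; exact: capvSr.
(* The two counts exclude each other, so a count of 1 refutes (i). *)
have card_neq : decomposes_into 1 (H `&` special_isometries B) (Defs.orbit H S) ->
    ~ decomposes_into 2 (H `&` special_isometries B) (Defs.orbit H S).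
  move=> c1 c2; have /card_eq_II // : (`I_1 #= `I_2)%card.
  by rewrite -(card_eql c1).
have [ran|ran] := eqVneq (2 * (r + a))%N n.
  have d2 : decomposes_into 2 (H `&` special_isometries B) (Defs.orbit H S).
    by apply: (decomposes_into_2 ndB H_isom H_comp H_inv Hs ds) => g; exact: stab1.
  by split; [right|split=> //; split=> // _; exact/iii].
have [g [Hg gS dg]] := stab2 (elimN eqP ran).
have d1 := decomposes_into_1 ndB H_isom H_comp H_inv Hs ds Hg gS dg.
split; [by left|split=> //; split=> [/(card_neq d1)//|/iii]].
by move/eqP; rewrite (negPf ran).
Qed.

Theorem theorem4p8 (R : realType) (n m r : nat) (V : vectType R[i])
    (B : {symmetric V}) (U W : {vspace V})
    (dimV : \dim {:V} = n) (ndB : nondegenerate B)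
    (UaddW : (U + W)%VS = {:V}%VS) (UcapW : (U :&: W)%VS = 0%VS)
    (UperpW : (U <= orthov B W)%VS)
    (dimU : \dim U = m) (dimW : \dim W = (n - m)%N)
    (m_gt0 : (0 < m)%N) (m_ltn : (m < n)%N) (r_le : (r <= n./2)%N)
    (H : set 'End(V)) (defH : H = product_isometries B U W)
    (G0 : set 'End(V)) (defG0 : G0 = special_isometries B)
    (rU rW a b : nat) (O : set {vspace V})
    (orbO : orbit_with_invariants B H U W r rU rW a b O) :
  (decomposes_into 1 (H `&` G0) O \/ decomposes_into 2 (H `&` G0) O)
  /\ (decomposes_into 2 (H `&` G0) O <->
        (2 * rU + 2 * a + b = m)%N /\ (2 * rW + 2 * a + b = n - m)%N)
  /\ ((2 * rU + 2 * a + b = m)%N /\ (2 * rW + 2 * a + b = n - m)%N <->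
        (2 * (r + a) = n)%N).
Proof.
(* The complex field [R[i]] has characteristic zero, so 2 is nonzero. *)
by apply: orbit_decomposition orbO => //; rewrite Num.Theory.pnatr_eq0.
Qed.
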